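(* Suppose $L$ is a Latin square of order $n$. Let $\theta=(\alpha,\beta,\gamma)$ be an autotopism of $L$ and let $\Lambda$ be a strongly lcm-closed set. If at least two of $R_\Lambda$, $C_\Lambda$ and $S_\Lambda$ are nonempty, then $|R_\Lambda|=|C_\Lambda|=|S_\Lambda|$ and $L$ contains a subsquare $M$ on the rows $R_\Lambda$, columns $C_\Lambda$ and symbols $S_\Lambda$. Moreover, $M$ admits the autotopism $\theta_M$. In addition, if $|R_\Lambda|=|C_\Lambda|=|S_\Lambda|=\tfrac12 n$ then $L$ has four subsquares, each with autotopisms induced by $\theta$ (by restriction of $\alpha,\beta,\gamma$ to its rows, columns and symbols, respectively). The subsquares are on the rows, columns and symbols $(R_\Lambda,C_\Lambda,S_\Lambda)$, $(R_\Lambda,\overline{C_\Lambda},\overline{S_\Lambda})$, $(\overline{R_\Lambda},C_\Lambda,\overline{S_\Lambda})$ and $(\overline{R_\Lambda},\overline{C_\Lambda},S_\Lambda)$.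
   Context: A Latin square of order $n$ is an $n\times n$ array $L=L(i,j)$ with rows, columns and symbols indexed by $[n]=\{1,\dots,n\}$ such that the symbols in every row and in every column are distinct. A triple $\theta=(\alpha,\beta,\gamma)\in S_n\times S_n\times S_n$ is an autotopism of $L$ if $\gamma(L(i,j))=L(\alpha(i),\beta(j))$ for all $i,j\in[n]$; the same definition applies to Latin squares whose rows, columns and symbols are indexed by arbitrary finite sets $R,C,S$ of equal size, with $\alpha,\beta,\gamma$ permutations of $R,C,S$ respectively. A nonempty subset $\Lambda\subseteq\mathbb N=\{1,2,\dots\}$ (finite or infinite) is strongly lcm-closed if for all $a,b\in\mathbb N$ we have $\mathrm{lcm}(a,b)\in\Lambda$ if and only if $a\in\Lambda$ and $b\in\Lambda$. Given $(\alpha,\beta,\gamma)$ and $\Lambda$, $R_\Lambda$ (respectively $C_\Lambda$, $S_\Lambda$) is the set of $i\in[n]$ such that the length of the cycle of $\alpha$ (respectively $\beta$, $\gamma$) containing $i$ belongs to $\Lambda$; fixed points count as cycles of length $1$. For $X\subseteq[n]$, $\overline X=[n]\setminus X$. A subsquare of $L$ is a submatrix that is itself a Latin square; it is on rows $R$, columns $C$ and symbols $S$ if it is formed by the rows indexed by $R$ and the columns indexed by $C$, and $S=\{L(i,j): i\in R, j\in C\}$, so $|R|=|C|=|S|$. When $R,C,S$ are closed under $\alpha,\beta,\gamma$ respectively, $\theta_M$ denotes the triple of the restrictions of $\alpha,\beta,\gamma$ to $R,C,S$ respectively. *)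

(* Defs.v *)
From mathcomp Require Import all_boot all_fingroup.
From mathcomp Require Import boolp classical_sets.

Set Implicit Arguments.
Unset Strict Implicit.
Unset Printing Implicit Defensive.

Section LatinSquares.
Variables R C S : finType.
Implicit Type L : R -> C -> S.

Definition latin_square L : Prop :=
  [/\ #|R| = #|C|, #|C| = #|S|,
      forall i : R, injective (L i)
    & forall j : C, injective (fun i => L i j)].

Definition autotopism L (alpha : {perm R}) (beta : {perm C})
    (gamma : {perm S}) : Prop :=
  forall i j, gamma (L i j) = L (alpha i) (beta j).

End LatinSquares.

(* M is a square in its own right, indexed by the finite types attached to the
   sets A, B and D. The order 0 is not excluded. *)
Definition subsquare (R C S : finType) (L : R -> C -> S)
    (A : {set R}) (B : {set C}) (D : {set S})
    (M : {i | i \in A} -> {j | j \in B} -> {s | s \in D}) : Prop :=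
  [/\ D = [set L i j | i in A, j in B]%SET,
      forall i j, val (M i j) = L (val i) (val j)
    & latin_square M].

(* Such a pA exists exactly when A is closed under p, and it is then unique. *)
Definition perm_restriction (T : finType) (p : {perm T}) (A : {set T})
    (pA : {perm {x | x \in A}}) : Prop :=
  forall x, val (pA x) = p (val x).

Definition induced_autotopism (R C S : finType)
    (alpha : {perm R}) (beta : {perm C}) (gamma : {perm S})
    (A : {set R}) (B : {set C}) (D : {set S})
    (M : {i | i \in A} -> {j | j \in B} -> {s | s \in D}) : Prop :=
  exists (alphaM : {perm {i | i \in A}}) (betaM : {perm {j | j \in B}})
         (gammaM : {perm {s | s \in D}}),
    [/\ perm_restriction alpha alphaM, perm_restriction beta betaM,
        perm_restriction gamma gammaM
      & autotopism M alphaM betaM gammaM].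

Definition has_invariant_subsquare (R C S : finType) (L : R -> C -> S)
    (alpha : {perm R}) (beta : {perm C}) (gamma : {perm S})
    (A : {set R}) (B : {set C}) (D : {set S}) : Prop :=
  exists M : {i | i \in A} -> {j | j \in B} -> {s | s \in D},
    subsquare L M /\ induced_autotopism alpha beta gamma M.

(* Lambda is a set of positive integers, hence the conditions on 0. *)
Definition strongly_lcm_closed (Lambda : set nat) : Prop :=
  [/\ exists a, Lambda a,
      ~ Lambda 0
    & forall a b, 0 < a -> 0 < b ->
        (Lambda (lcmn a b) <-> Lambda a /\ Lambda b)].

(* porbit p x is the cycle of p through x, with a single element if p fixes x. *)
Definition cycle_length_in (T : finType) (p : {perm T}) (Lambda : set nat) :
    {set T} :=
  [set x | `[< Lambda #|porbit p x| >]]%SET.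

(* Main.v *)
(* If (a, b, c) are the cycle lengths of i, j and L(i, j), each divides the lcm
   of the other two, because alpha^m(i) = i and beta^m(j) = j force
   gamma^m(L(i, j)) = L(i, j), and similarly for the other two roles. Hence two
   lengths in Lambda force the third: a Latin row or column then restricts to a
   bijection between any two of the three sets. When each set has n/2 elements,
   a column outside C_Lambda maps R_Lambda onto the complement of S_Lambda, so
   it maps the complement of R_Lambda into S_Lambda. *)
Require Import Defs.
From mathcomp Require Import all_boot all_fingroup.
From mathcomp Require Import boolp classical_sets.

Set Implicit Arguments.
Unset Strict Implicit.
Unset Printing Implicit Defensive.

Lemma card_porbit_gt0 (T : finType) (p : {perm T}) (x : T) :
  0 < #|porbit p x|.
Proof. by rewrite card_gt0; apply/set0Pn; exists x; exact: porbit_id. Qed.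

(** Turns divisibility by a cycle length into a fixed-point equation. Reduce [m] modulo the length
    [c]; the first [c] iterates of [x] are distinct, so iterate [m %% c] equals iterate 0 only if
    [m %% c = 0]. *)
Lemma dvdn_card_porbit (T : finType) (p : {perm T}) (x : T) (m : nat) :
  (#|porbit p x| %| m) = (iter m p x == x).
Proof.
set c := #|porbit p x|.
have c0 : 0 < c := card_porbit_gt0 p x.
have itq q : iter (q * c) p x = x.
  by elim: q => // q IH; rewrite mulSn iterD IH iter_porbit.
have -> : iter m p x = iter (m %% c) p x.
  by rewrite {1}(divn_eq m c) addnC iterD itq.
have rc : m %% c < size (traject p x c) by rewrite size_traject ltn_mod.
have zc : 0 < size (traject p x c) by rewrite size_traject.
have := nth_uniq x rc zc (uniq_traject_porbit p x).
by rewrite !nth_traject ?ltn_mod // /dvdn => ->.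
Qed.

(** Since [c] divides [l = lcmn a b], the lcm of [c] and [l] is [l] itself. Closure puts [l] in
    [Lambda], and its converse, applied to [c] and [l], then gives [c]. *)
Lemma strongly_lcm_closed_dvdn_lcm (Lambda : set nat) (a b c : nat) :
  strongly_lcm_closed Lambda -> 0 < a -> 0 < b ->
  Lambda a -> Lambda b -> c %| lcmn a b -> Lambda c.
Proof.
move=> [_ _ H] a0 b0 La Lb cab.
have l0 : 0 < lcmn a b by rewrite lcmn_gt0 a0.
have c0 : 0 < c := dvdn_gt0 l0 cab.
have /(H c _ c0 l0) [] // : Lambda (lcmn c (lcmn a b)).
by have /lcmn_idPr -> := cab; apply/(H a b a0 b0).
Qed.

Lemma cycle_length_in_perm (T : finType) (p : {perm T}) (Lambda : set nat)
    (x : T) :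
  (p x \in cycle_length_in p Lambda) = (x \in cycle_length_in p Lambda).
Proof.
rewrite !inE; have /eqP -> // : porbit p (p x) == porbit p x.
by rewrite eq_porbit_mem -{1}[p]expg1 mem_porbit.
Qed.

Lemma perm_restriction_exists (T : finType) (p : {perm T}) (A : {set T}) :
  (forall x, (p x \in A) = (x \in A)) ->
  exists pA : {perm {x | x \in A}}, perm_restriction p pA.
Proof.
move=> pA.
have h (x : {x | x \in A}) : p (val x) \in A by rewrite pA (valP x).
have inj : injective (fun x : {x | x \in A} => Sub (p (val x)) (h x) : {x | x \in A}).
  by move=> x y /(congr1 val); rewrite !SubK => /perm_inj /val_inj.
by exists (perm inj) => x; rewrite permE SubK.
Qed.

Section LatinSquare.
Variables (R C S : finType) (L : R -> C -> S).
Hypothesis latinL : latin_square L.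

Let rowI (i : R) : injective (L i). Proof. by case: latinL. Qed.
Let colI (j : C) : injective (L^~ j). Proof. by case: latinL. Qed.

Lemma latin_row_onto (i : R) (s : S) : exists j, L i j = s.
Proof.
have [_ eCS _ _] := latinL.
have /codomP [j ->] : s \in codom (L i).
  by apply: (inj_card_onto (@rowI i)); rewrite eCS.
by exists j.
Qed.

Lemma latin_col_onto (j : C) (s : S) : exists i, L i j = s.
Proof.
have [eRC eCS _ _] := latinL.
have /codomP [i ->] : s \in codom (L^~ j).
  by apply: (inj_card_onto (@colI j)); rewrite eRC eCS.
by exists i.
Qed.

Variables (alpha : {perm R}) (beta : {perm C}) (gamma : {perm S}).
Hypothesis autL : autotopism L alpha beta gamma.

Lemma invariant_subsquare (A : {set R}) (B : {set C}) (D : {set S}) :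
  #|A| = #|B| -> #|B| = #|D| ->
  (forall i, (alpha i \in A) = (i \in A)) ->
  (forall j, (beta j \in B) = (j \in B)) ->
  (forall s, (gamma s \in D) = (s \in D)) ->
  (forall i j, i \in A -> j \in B -> L i j \in D) ->
  has_invariant_subsquare L alpha beta gamma A B D.
Proof.
move=> eAB eBD clA clB clD LD.
have h (i : {i | i \in A}) (j : {j | j \in B}) : L (val i) (val j) \in D.
  by apply: LD; exact: valP.
pose M i j : {s | s \in D} := Sub (L (val i) (val j)) (h i j).
exists M; split; first split=> //.
- apply/esym/eqP; rewrite eqEcard; apply/andP; split.
    by apply/fintype.subsetP=> s /imset2P [i j iA jB ->]; exact: LD.
  (* Unless the subsquare is empty, a single row [i] in [A] already shows [#|B|] distinct symbols,
     as many as [D] has. *)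
  rewrite -eBD; have [B0|[j jB]] := set_0Vmem B; first by rewrite B0 cards0.
  have /card_gt0P [i iA] : 0 < #|A| by rewrite eAB; apply/card_gt0P; exists j.
  rewrite -(card_imset (mem B) (@rowI i)); apply: subset_leq_card.
  by apply/fintype.subsetP=> s /imsetP [k kB ->]; exact: imset2_f.
- split; rewrite ?card_sig //.
  + by move=> i j k /(congr1 val); rewrite !SubK => /rowI /val_inj.
  + by move=> j i k /(congr1 val); rewrite !SubK => /colI /val_inj.
have [aM aMP] := perm_restriction_exists clA.
have [bM bMP] := perm_restriction_exists clB.
have [gM gMP] := perm_restriction_exists clD.
exists aM, bM, gM; split=> // i j; apply: val_inj.
by rewrite gMP !SubK autL aMP bMP.
Qed.

Lemma autotopism_iter (m : nat) (i : R) (j : C) :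
  iter m gamma (L i j) = L (iter m alpha i) (iter m beta j).
Proof. by elim: m => //= m ->; exact: autL. Qed.

Variable Lambda : set nat.
Hypothesis lcmL : strongly_lcm_closed Lambda.

Let RL := cycle_length_in alpha Lambda.
Let CL := cycle_length_in beta Lambda.
Let SL := cycle_length_in gamma Lambda.

Lemma cycle_length_in_symbol (i : R) (j : C) :
  i \in RL -> j \in CL -> L i j \in SL.
Proof.
rewrite !inE => Li Lj.
apply: (strongly_lcm_closed_dvdn_lcm lcmL _ _ Li Lj); try exact: card_porbit_gt0.
rewrite dvdn_card_porbit autotopism_iter.
have := dvdn_lcml #|porbit alpha i| #|porbit beta j|.
have := dvdn_lcmr #|porbit alpha i| #|porbit beta j|.
by rewrite !dvdn_card_porbit => /eqP -> /eqP ->.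
Qed.

(** Let [m] be the lcm of the cycle lengths of [i] and [L i j]. The m-th iterates fix both, so row
    [i] has the same symbol in column [j] and in its m-th image under [beta]; injectivity of the row
    identifies these columns. *)
Lemma cycle_length_in_col (i : R) (j : C) :
  i \in RL -> L i j \in SL -> j \in CL.
Proof.
rewrite !inE => Li Ls.
apply: (strongly_lcm_closed_dvdn_lcm lcmL _ _ Li Ls); try exact: card_porbit_gt0.
have := dvdn_lcml #|porbit alpha i| #|porbit gamma (L i j)|.
have := dvdn_lcmr #|porbit alpha i| #|porbit gamma (L i j)|.
rewrite !dvdn_card_porbit autotopism_iter => /eqP + /eqP ei.
by rewrite ei => /rowI ->.
Qed.

Lemma cycle_length_in_row (i : R) (j : C) :
  j \in CL -> L i j \in SL -> i \in RL.
Proof.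
rewrite !inE => Lj Ls.
apply: (strongly_lcm_closed_dvdn_lcm lcmL _ _ Lj Ls); try exact: card_porbit_gt0.
have := dvdn_lcml #|porbit beta j| #|porbit gamma (L i j)|.
have := dvdn_lcmr #|porbit beta j| #|porbit gamma (L i j)|.
rewrite !dvdn_card_porbit autotopism_iter => /eqP + /eqP ej.
by rewrite ej => /colI ->.
Qed.

(** Row [i] restricts to a bijection from [CL] to [SL]: a symbol of [SL] occurs somewhere in the
    row, necessarily in a column of [CL]. *)
Lemma card_cycle_length_in_col (i : R) : i \in RL -> #|CL| = #|SL|.
Proof.
move=> iR; rewrite -(card_imset (mem CL) (@rowI i)); apply: eq_card => s.
apply/imsetP/idP => [[j jC ->]|]; first exact: cycle_length_in_symbol.
have [j <-] := latin_row_onto i s => sS.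
by exists j => //; exact: cycle_length_in_col iR sS.
Qed.

Lemma card_cycle_length_in_row (j : C) : j \in CL -> #|RL| = #|SL|.
Proof.
move=> jC; rewrite -(card_imset (mem RL) (@colI j)); apply: eq_card => s.
apply/imsetP/idP => [[i iR ->]|]; first exact: cycle_length_in_symbol.
have [i <-] := latin_col_onto j s => sS.
by exists i => //; exact: cycle_length_in_row jC sS.
Qed.

(** Column [j] sends [RL] into [~: SL], since a symbol of [SL] would force [j] into [CL]. By
    counting it fills [~: SL], so injectivity leaves only symbols of [SL] for rows outside [RL]. *)
Lemma cycle_length_in_symbol_compl (i : R) (j : C) :
  #|RL| = #|~: SL| -> i \notin RL -> j \notin CL -> L i j \in SL.
Proof.
move=> eRS iR jC; apply: contraR iR => sS.
have sub : [set L k j | k in RL]%SET \subset ~: SL.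
  apply/fintype.subsetP=> s /imsetP [k kR ->]; rewrite inE.
  by apply: contra jC; exact: cycle_length_in_col kR.
have /eqP E : [set L k j | k in RL]%SET == ~: SL.
  by rewrite eqEcard sub card_imset ?eRS //=; exact: colI.
have : L i j \in ~: SL by rewrite inE.
by rewrite -E => /imsetP [k kR /colI ->].
Qed.

End LatinSquare.

Theorem theorem3p7 (n : nat) (L : 'I_n -> 'I_n -> 'I_n)
    (alpha beta gamma : {perm 'I_n}) (Lambda : set nat) :
  latin_square L ->
  autotopism L alpha beta gamma ->
  strongly_lcm_closed Lambda ->
  let RL := cycle_length_in alpha Lambda in
  let CL := cycle_length_in beta Lambda in
  let SL := cycle_length_in gamma Lambda in
  ((RL <> finset.set0 /\ CL <> finset.set0) \/
   (RL <> finset.set0 /\ SL <> finset.set0) \/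
   (CL <> finset.set0 /\ SL <> finset.set0) ->
     [/\ #|RL| = #|CL|, #|CL| = #|SL|
       & has_invariant_subsquare L alpha beta gamma RL CL SL])
  /\
  (2 * #|RL| = n -> 2 * #|CL| = n -> 2 * #|SL| = n ->
     [/\ has_invariant_subsquare L alpha beta gamma RL CL SL,
         has_invariant_subsquare L alpha beta gamma RL (~: CL) (~: SL),
         has_invariant_subsquare L alpha beta gamma (~: RL) CL (~: SL)
       & has_invariant_subsquare L alpha beta gamma (~: RL) (~: CL) SL]).
Proof.
move=> latL autL lcmL RL CL SL.
have clR i : (alpha i \in RL) = (i \in RL) by exact: cycle_length_in_perm.
have clC j : (beta j \in CL) = (j \in CL) by exact: cycle_length_in_perm.
have clS s : (gamma s \in SL) = (s \in SL) by exact: cycle_length_in_perm.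
have toS := cycle_length_in_symbol autL lcmL.
split=> [ne|cR cC cS].
  (* When [SL] is one of the two nonempty sets, locating its symbol [y] in the given row or column
     [x] supplies the missing index. *)
  have [i iR [j jC]] : exists2 i, i \in RL & exists j, j \in CL.
    case: ne => [[]|[[]|[]]] /eqP/set0Pn [x xP] /eqP/set0Pn [y yP].
    - by exists x => //; exists y.
    - have [j e] := latin_row_onto latL x y; exists x => //; exists j.
      by apply: (cycle_length_in_col latL autL lcmL xP); rewrite e.
    - have [i e] := latin_col_onto latL x y; exists i; last by exists x.
      by apply: (cycle_length_in_row latL autL lcmL xP); rewrite e.
  have eCS : #|CL| = #|SL| := card_cycle_length_in_col latL autL lcmL iR.
  have eRS : #|RL| = #|SL| := card_cycle_length_in_row latL autL lcmL jC.
  have eRC : #|RL| = #|CL| by rewrite eRS.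
  by split=> //; exact: invariant_subsquare.
have half (X : {set 'I_n}) : 2 * #|X| = n -> #|~: X| = #|X|.
  by move=> e; apply/eqP; rewrite -(eqn_add2l #|X|) cardsC card_ord addnn -mul2n e.
(* The sizes are compared through the halves, which also covers [n = 0], where all three sets are
   empty. *)
have eRC : #|RL| = #|CL| by apply/eqP; rewrite -(eqn_pmul2l (m := 2)) // cR cC.
have eCS : #|CL| = #|SL| by apply/eqP; rewrite -(eqn_pmul2l (m := 2)) // cC cS.
have [hR hC hS] : [/\ #|~: RL| = #|RL|, #|~: CL| = #|CL| & #|~: SL| = #|SL|].
  by split; exact: half.
(* What remains is where the symbols fall in the last three blocks: the two mixed ones are
   contrapositives, and only the block [~: RL], [~: CL] needs the counting argument. *)
split; apply: invariant_subsquare; rewrite ?hR ?hC ?hS -?eCS -?eRC //;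
  try by move=> x; rewrite !finset.in_setC ?clR ?clC ?clS.
- move=> i j iR; rewrite !finset.in_setC; apply: contra.
  exact: (cycle_length_in_col latL autL lcmL iR).
- move=> i j; rewrite !finset.in_setC => iR jC; apply: contra iR.
  exact: (cycle_length_in_row latL autL lcmL jC).
- move=> i j; rewrite !finset.in_setC; apply: cycle_length_in_symbol_compl => //.
  by rewrite -/RL -/SL hS eRC.
Qed.
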